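(* Let $S=X\times Y$ be a compact Polish space (with $X,Y$ Polish), $\mu^*\in P(S)$, $\varepsilon\ge0$, $G\in\mathcal{G}$. Assume that $c:S\times S\to\mathbb{R}_+$ is non-negative, continuous, and such that $c(s,r)=0$ if and only if $s=r$, and that $\ell(\cdot,G)$ is continuous. For $(x,y)\in S$ let $$K_{(x,y)}=\{\delta_x\otimes\mu_{Y|X=x}\ :\ \mu_{Y|X}\in P(Y|X)\},$$ where $P(Y|X)$ denotes the set of Markov kernels $X\to P(Y)$, and suppose that $K_s$ is non-empty, weakly* closed and convex for $\mu^*$-a.e. $s\in S$ and that $\Omega_{K,c,\varepsilon}$ is non-empty. Then $$I_{\Omega_{K,c,\varepsilon}}(G)=\inf_{\lambda\ge0}\left(\lambda\varepsilon+\int_S\phi_{\lambda,G}(x,y)\,d\mu^*(x,y)\right),$$ where $$\phi_{\lambda,G}(x,y):=\sup_{v\in Y}\Big(\ell(x,v,G)-\lambda c\big((x,y),(x,v)\big)\Big).$$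
   Context: $P(S)$ is the set of Borel probability measures on $S$; weak* closedness in $P(S)$ refers to the duality with $C(S)$. $\delta_x$ is the Dirac measure at $x$. $\mathcal{G}$ is a parameter space and $\ell:S\times\mathcal{G}\to[0,\infty)$ is a measurable loss function, written $\ell(u,v,G)$ for $\ell((u,v),G)$. The notation $\pi_{S|S}:S\to K_s$ means a $\mu^*$-measurable kernel $s\mapsto\pi_{S|S=s}\in P(S)$ such that $\pi_{S|S=s}\in K_s$ for $\mu^*$-a.e. $s\in S$. Define $$\Omega_{K,c,\varepsilon}:=\Big\{\pi_{S|S}:S\to K_s\ :\ \int_S\int_S c(s,r)\,d\pi_{S|S=s}(r)\,d\mu^*(s)\le\varepsilon\Big\},$$ $$I_{\Omega_{K,c,\varepsilon}}(G):=\sup_{\pi_{S|S}\in\Omega_{K,c,\varepsilon}}\int_S\int_S\ell(r,G)\,d\pi_{S|S=s}(r)\,d\mu^*(s).$$ *)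

(* Defs.v *)
From HB Require Import structures.
From mathcomp Require Import all_boot all_order all_algebra.
From mathcomp Require Import all_classical all_reals all_analysis.

Set Implicit Arguments.
Unset Strict Implicit.
Unset Printing Implicit Defensive.

Import Order.TTheory GRing.Theory Num.Theory.
Import numFieldNormedType.Exports.

Local Open Scope classical_set_scope.
Local Open Scope ring_scope.

(* Declares the join [ptopologicalType] on products. *)
HB.saturate prod.

Definition is_metric (R : realType) (T : Type) (d : T -> T -> R) : Prop :=
  [/\ forall x y, 0 <= d x y,
      forall x y, d x y = 0 <-> x = y,
      forall x y, d x y = d y x &
      forall x y z, d x z <= d x y + d y z].

Definition metrizes (R : realType) (T : topologicalType) (d : T -> T -> R) :
    Prop :=
  forall (x : T) (A : set T),
    nbhs x A <-> exists2 e : R, 0 < e & [set y | d x y < e] `<=` A.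

Definition complete_metric (R : realType) (T : topologicalType)
    (d : T -> T -> R) : Prop :=
  forall u : nat -> T,
    (forall e : R, 0 < e ->
      exists N : nat, forall m n : nat,
        (N <= m)%N -> (N <= n)%N -> d (u m) (u n) < e) ->
    exists l : T, u @ \oo --> l.

Definition separable (T : topologicalType) : Prop :=
  exists2 D : set T, countable D & dense D.

Definition polish (R : realType) (T : topologicalType) : Prop :=
  separable T /\
  exists d : T -> T -> R, [/\ is_metric d, metrizes d & complete_metric d].

Definition borel (T : ptopologicalType) : measurableType (@open T).-sigma :=
  g_sigma_algebraType (@open T).

(* The domain of the completion of [mu]: for a finite measure, the
   Caratheodory-measurable sets of the outer measure of [mu] are exactly the
   sets that differ from a measurable set by a subset of a [mu]-null set. *)
Notation completed mu := (caratheodory_type (mu_ext mu)).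

Notation completion mu := (@completed_measure_extension _ _ _ mu).

(* [k x] as an element of [probability Y R]: the library gives the values of a
   probability kernel only the structure of a measure. *)
Section pker_at.
Context d d' (X : measurableType d) (Y : measurableType d') (R : realType).
Variables (k : R.-pker X ~> Y) (x : X).

Definition pker_at : set Y -> \bar R := k x.

HB.instance Definition _ := Measure.on pker_at.
HB.instance Definition _ :=
  Measure_isProbability.Build _ _ _ pker_at (prob_kernel x).

End pker_at.

(* P(T) with the coarsest topology making [nu |-> \int f dnu] continuous for
   every continuous [f : T -> R]; meant for compact [T], where these integrals
   are finite. *)
Definition weak_star (R : realType) (T : ptopologicalType) :=
  @initial_topology (probability (borel T) R) {ptws continuousType T R -> R}
    (fun nu f => \int[nu]_x f x).

Definition weak_star_closed (R : realType) (T : ptopologicalType)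
    (K : set (probability (borel T) R)) : Prop :=
  closed (K : set (weak_star R T)).

(* The library compares measures on all sets, measurable or not, so a convex
   combination is specified by its values on the measurable sets. *)
Definition convex_prob d (T : measurableType d) (R : realType)
    (K : set (probability T R)) : Prop :=
  forall (t : R) (nu1 nu2 nu : probability T R),
    0 <= t <= 1 -> K nu1 -> K nu2 ->
    (forall A, measurable A ->
      nu A = (t%:E * nu1 A + (1 - t)%:E * nu2 A)%E) ->
    K nu.

(* The product measure lives on the product of the Borel sigma-algebras of [X]
   and [Y], which is the Borel sigma-algebra of [X * Y] for Polish [X], [Y]. *)
Definition K_dirac (R : realType) (X Y : ptopologicalType)
    (s : X * Y) : set (probability (borel (X * Y)%type) R) :=
  [set nu | exists kappa : R.-pker (borel X) ~> (borel Y),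
    forall A : set (borel (X * Y)%type), measurable A ->
      nu A = (\d_(s.1 : borel X) \x kappa s.1)%E A].

Arguments K_dirac R {X Y} s.

Section Omega.
Local Open Scope ereal_scope.
Context (R : realType) (S : ptopologicalType).
Variable mu : probability (borel S) R.

Definition Omega (K : S -> set (probability (borel S) R)) (c : S -> S -> R)
    (eps : R) : set (R.-pker (completed mu) ~> (borel S)) :=
  [set pi : R.-pker (completed mu) ~> (borel S) |
    (\forall s \ae completion mu, K s (pker_at pi s)) /\
    \int[completion mu]_s \int[pi s]_r (c s r)%:E <= eps%:E].

Definition worst_case (G : Type) (l : S -> G -> R)
    (Om : set (R.-pker (completed mu) ~> (borel S))) (g : G) : \bar R :=
  ereal_sup [set \int[completion mu]_s \int[pi s]_r (l r g)%:E | pi in Om].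

End Omega.

Arguments Omega {R S} mu K c eps.

Definition phi (R : realType) (X Y G : Type) (l : X * Y -> G -> R)
    (c : X * Y -> X * Y -> R) (lambda : R) (g : G) (s : X * Y) : \bar R :=
  ereal_sup [set (l (s.1, v) g - lambda * c s (s.1, v))%:E | v in [set: Y]].

(* Main.v *)
(* Weak duality: for pi feasible, almost every pi_s lives on the fibre over the
   first coordinate of s, where l <= phi_lambda(s) + lambda c(s, .); integrate.
   Strong duality, eps > 0: the pairs (transport cost, expected loss) achieved
   by admissible kernels form a convex set of the plane, so the optimal value is
   concave in the budget and has a supergradient lambda at eps.  The kernels
   s |-> dirac at (s.1, v(s)), where v(s) is a measurable delta-maximiser chosen
   from a dense sequence of Y, show this lambda to be dual optimal up to delta.
   For eps = 0 there may be no dual optimiser; there, compactness gives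
   l(r) <= l(s) + delta + lambda c(s, r) uniformly for some lambda. *)
Require Import Defs.
From HB Require Import structures.
From mathcomp Require Import all_boot all_order all_algebra.
From mathcomp Require Import all_classical all_reals all_analysis.
From mathcomp Require Import measurable_realfun ring lra.

Set Implicit Arguments.
Unset Strict Implicit.
Unset Printing Implicit Defensive.

Import Order.TTheory GRing.Theory Num.Theory.
Import numFieldNormedType.Exports.

Local Open Scope classical_set_scope.
Local Open Scope ring_scope.

(** * Countable bases and Borel measurability *)

Lemma polish_second_countable (R : realType) (T : topologicalType) :
  polish R T -> @second_countable T.
Proof.
move=> [[D cD dD] [d [[d0 d_eq0 dC dT] dN _]]].
have ball_open x r : open [set y | d x y < r].
  rewrite openE => y /= dxy; apply/dN; exists (r - d x y).
    by rewrite subr_gt0.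
  by move=> z /= dyz; have := dT x y z; lra.
exists [set [set y | d p.1 y < p.2.+1%:R^-1] | p in D `*` [set: nat]].
  by apply: sub_countable (card_image_le _ _) _; exact: countableX.
split=> [_ [p _ <-]//|x A /dN[e e0 xeA]].
(* With a radius below [e / 2], the ball around a point [z] of [D] that is this close to [x]
   contains [x] and stays inside the [e]-ball of [x]. *)
have [n] : exists n, 0 + n.+1%:R^-1 < e / 2.
  by apply: ltr_add_invr; rewrite divr_gt0.
rewrite add0r => ne.
have [] := dD [set y | d x y < n.+1%:R^-1].
- by exists x; rewrite /= (d_eq0 x x).2.
- exact: ball_open.
move=> z [/= xz Dz]; exists [set y | d z y < n.+1%:R^-1]; last first.
  move=> y /= zy; apply: xeA => /=; apply: le_lt_trans (dT x z y) _.
  by rewrite (splitr e) ltrD// (lt_trans _ ne).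
by split; [exists (z, n)|rewrite /= dC].
Qed.

Lemma polish_hausdorff (R : realType) (T : topologicalType) :
  polish R T -> hausdorff_space T.
Proof.
move=> [_ [d [[d0 d_eq0 dC dT] dN _]]] x y xy.
apply/d_eq0/eqP; rewrite eq_le d0 andbT leNgt; apply/negP => dxy.
have [] := xy [set z | d x z < d x y / 2] [set z | d y z < d x y / 2].
- by apply/dN; exists (d x y / 2) => //; rewrite divr_gt0.
- by apply/dN; exists (d x y / 2) => //; rewrite divr_gt0.
move=> z [/= xz yz]; have := dT x z y; rewrite (dC z y); lra.
Qed.

Lemma second_countable_prod (T1 T2 : topologicalType) :
  @second_countable T1 -> @second_countable T2 ->
  @second_countable (T1 * T2)%type.
Proof.
move=> [B1 cB1 [oB1 bB1]] [B2 cB2 [oB2 bB2]].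
exists [set p.1 `*` p.2 | p in B1 `*` B2].
  by apply: sub_countable (card_image_le _ _) _; exact: countableX.
split=> [_ [[U V] [/= BU BV] <-]|[x y] A [[U V] /= [xU yV] UVA]].
  rewrite openE => -[x y] [/= Ux Vy]; exists (U, V) => //=.
  by split; apply: open_nbhs_nbhs; split => //; [exact: oB1|exact: oB2].
have [U' [BU' U'x] U'U] := bB1 x U xU.
have [V' [BV' V'y] V'V] := bB2 y V yV.
exists (U' `*` V'); first by split => //; exists (U', V').
by move=> [u v] [/= /U'U Uu /V'V Vv]; apply: UVA.
Qed.

Lemma open_borel_measurable (T : ptopologicalType) (A : set (borel T)) :
  open (A : set T) -> measurable A.
Proof. exact: sub_sigma_algebra. Qed.

(** An injection of the index set into [nat] rewrites the union as a sequence whose terms are each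
    empty or a single [F i]. *)
Lemma countable_bigcup_measurable d (T : sigmaRingType d) I (D : set I)
    (F : I -> set T) : countable D ->
  (forall i, D i -> measurable (F i)) -> measurable (\bigcup_(i in D) F i).
Proof.
move=> /countable_injP[f finj] mF.
have -> : \bigcup_(i in D) F i =
    \bigcup_n \bigcup_(i in [set i | D i /\ f i = n]) F i.
  apply/seteqP; split => [x [i Di Fix]|x [_ _ [i [Di _] Fix]]].
    by exists (f i) => //; exists i.
  by exists i.
apply: bigcupT_measurable => n.
have [[i [Di fin]]|noi] := pselect (exists i, D i /\ f i = n); last first.
  rewrite (_ : [set i | _] = set0) ?bigcup_set0//.
  by apply/seteqP; split => // i Dfi; apply: noi; exists i.
rewrite (_ : [set i | _] = [set i]) ?bigcup_set1; first exact: mF.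
apply/seteqP; split => [j [Dj fjn]|_ ->//].
by apply: finj; rewrite ?inE// fin.
Qed.

(** The base rectangles inside an open set are countably many and cover it. Jointly continuous
    functions thus become measurable for the product sigma-algebra, the one used in integrating
    against kernels. *)
Lemma open_prod_borel_measurable (T1 T2 : ptopologicalType)
    (A : set (borel T1 * borel T2)) :
  @second_countable T1 -> @second_countable T2 ->
  open (A : set (T1 * T2)%type) -> measurable A.
Proof.
move=> [B1 cB1 [oB1 bB1]] [B2 cB2 [oB2 bB2]] oA.
have -> : A = \bigcup_(p in [set p | [/\ B1 p.1, B2 p.2 & p.1 `*` p.2 `<=` A]])
    (p.1 `*` p.2).
  apply/seteqP; split => [[x y] Axy|z [[U V] [_ _]]]; last exact.
  have /nbhs_interior : nbhs ((x, y) : T1 * T2) A by exact: open_nbhs_nbhs.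
  move=> /nbhs_singleton [[U V] /= [xU yV] UVA].
  have [U' [BU' U'x] U'U] := bB1 x U xU.
  have [V' [BV' V'y] V'V] := bB2 y V yV.
  exists (U', V') => //; split => //= -[u v] [/= /U'U Uu /V'V Vv].
  exact: UVA.
apply: countable_bigcup_measurable => [|[U V] [BU BV _] /=].
  apply: sub_countable (countableX cB1 cB2).
  by apply: subset_card_le => -[U V] [].
by apply: measurableX; apply: open_borel_measurable; [exact: oB1|exact: oB2].
Qed.

Lemma continuous_borel_measurable (R : realType) (T : ptopologicalType)
    (f : T -> R) : continuous f -> measurable_fun [set: borel T] f.
Proof.
move=> /continuousP cf; apply: (measurability _ (RGenOInfty.measurableE R)).
move=> _ [_ [x ->] <-]; rewrite setTI; apply: open_borel_measurable.
exact/cf/interval_open.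
Qed.

Lemma continuous_prod_borel_measurable (R : realType) (T1 T2 : ptopologicalType)
    (f : T1 * T2 -> R) : @second_countable T1 -> @second_countable T2 ->
  continuous f -> measurable_fun [set: (borel T1 * borel T2)%type] f.
Proof.
move=> sT1 sT2 /continuousP cf.
apply: (measurability _ (RGenOInfty.measurableE R)).
move=> _ [_ [x ->] <-]; rewrite setTI; apply: open_prod_borel_measurable => //.
exact/cf/interval_open.
Qed.

Lemma continuous_borel (T1 T2 : ptopologicalType) (f : T1 -> T2) :
  continuous f -> measurable_fun [set: borel T1] (f : _ -> borel T2).
Proof.
move=> /continuousP cf.
apply: (@measurability _ _ (borel T1) (borel T2) setT f (@open T2) erefl).
by move=> _ [A oA <-]; rewrite setTI; apply: open_borel_measurable; exact: cf.
Qed.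

(** * Completion of a probability measure *)

Section completion.
Context d (T : measurableType d) (R : realType).
Variable P : probability T R.
Local Open Scope ereal_scope.

Lemma measurable_completed (A : set T) :
  measurable A -> measurable (A : set (completed P)).
Proof. by move=> mA; apply: sub_caratheodory; exact: sub_sigma_algebra. Qed.

Lemma completionE (A : set T) : measurable A -> completion P A = P A.
Proof. exact: measurable_mu_extE. Qed.

Lemma measurable_fun_completed d' (U : measurableType d') (f : T -> U) :
  measurable_fun setT f -> measurable_fun setT (f : completed P -> U).
Proof.
by move=> mf _ A mA; apply: measurable_completed; exact: (mf measurableT).
Qed.

Lemma ae_completed (Q : set T) :
  (\forall x \ae P, Q x) -> \forall x \ae completion P, Q x.
Proof.
move=> [N [mN PN QN]]; exists N; split => //; first exact: measurable_completed.
by rewrite -PN; exact: completionE.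
Qed.

Lemma completion_ae_filter : Filter (almost_everywhere (completion P)).
Proof. exact: ae_filter_ringOfSetsType. Qed.

(** The identity from the completed space to the original one is measurable and pushes the
    completion forward to [P]. *)
Lemma ge0_integral_completion (f : T -> \bar R) :
  (forall x, 0 <= f x) -> measurable_fun setT f ->
  \int[completion P]_x f x = \int[P]_x f x.
Proof.
move=> f0 mf.
have mid : measurable_fun setT (idfun : completed P -> T).
  by apply: measurable_fun_completed; exact: measurable_id.
have := ge0_integral_pushforward mid (completion P) measurableT mf
  (fun y _ => f0 y).
rewrite preimage_setT /= => <-; apply: eq_measure_integral => A mA _.
exact: completionE.
Qed.

End completion.
Arguments measurable_fun_completed {d T R} P {d' U f}.
Arguments completion_ae_filter {d T R} P.

(** * Supporting slopes of a convex set in the plane *)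

Lemma convex_supergradient (R : realType) (Z : set (R * R)) (e w : R) :
  (forall t z1 z2, 0 <= t <= 1 -> Z z1 -> Z z2 ->
     Z (t * z1.1 + (1 - t) * z2.1, t * z1.2 + (1 - t) * z2.2)) ->
  (exists2 z, Z z & z.1 < e) ->
  (forall z, Z z -> z.1 <= e -> z.2 <= w) ->
  exists2 lambda, 0 <= lambda &
    forall z, Z z -> z.2 + lambda * (e - z.1) <= w.
Proof.
move=> cZ [z0 Zz0 z0e] Zw.
(* [L] collects the slopes from points left of [e] to the point [(e, w)]. Its infimum is the largest
   [lambda] that all those points allow. *)
pose L := [set (w - z.2) / (e - z.1) | z in [set z | Z z /\ z.1 < e]].
have L0 : lbound L 0.
  move=> _ [z [Zz ze] <-]; rewrite divr_ge0// subr_ge0; last exact: ltW.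
  by apply: Zw => //; exact: ltW.
have neL : L !=set0 by exists ((w - z0.2) / (e - z0.1)); exists z0.
have hasL : has_inf L by split => //; exists 0.
exists (inf L) => [|[a b] Zab /=]; first exact: lb_le_inf.
have [ae|ea|ae] := ltgtP a e; last first.
- by rewrite ae subrr mulr0 addr0; apply: (Zw _ Zab); rewrite /= ae.
- have ae0 : 0 < a - e by rewrite subr_gt0.
  suff : (b - w) / (a - e) <= inf L by rewrite ler_pdivrMr//; lra.
  apply: lb_le_inf => // _ [[a' b'] [/= Zz' ae'] <-].
  have ea'0 : 0 < e - a' by rewrite subr_gt0.
  rewrite ler_pdivrMr// mulrAC ler_pdivlMr//.
  have aa' : 0 < a - a' by lra.
  have aa'0 : a - a' != 0 by rewrite gt_eqF.
  (* With weight [t] the chord joining the two points crosses the vertical line at [e]. Its height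
     there is at most [w], so the slope required by a point on the right is below every slope in
     [L]. *)
  pose t := (e - a') / (a - a').
  have t01 : 0 <= t <= 1.
    rewrite /t divr_ge0 ?(ltW ea'0) ?(ltW aa')//= ler_pdivrMr//; lra.
  have := Zw _ (cZ t _ _ t01 Zab Zz') => /=.
  have -> : t * a + (1 - t) * a' = e by rewrite /t; field.
  move=> /(_ (lexx _)).
  have -> : t * b + (1 - t) * b' = ((e - a') * b + (a - e) * b') / (a - a').
    by rewrite /t; field.
  rewrite ler_pdivrMr//; nra.
- have ea0 : 0 < e - a by rewrite subr_gt0.
  suff : inf L <= (w - b) / (e - a) by rewrite ler_pdivlMr//; lra.
  by apply: ge_inf; [exists 0|exists (a, b)].
Qed.

(** * Mixtures of probability kernels *)

Section kernel_mixture.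
Context d d' (T : measurableType d) (U : measurableType d') (R : realType).
Variables (t : R) (t0 : 0 <= t) (t1 : 0 <= 1 - t) (k1 k2 : R.-pker T ~> U).

Definition kernel_mixture (x : T) : {measure set U -> \bar R} :=
  measure_add (mscale (NngNum t0) (k1 x)) (mscale (NngNum t1) (k2 x)).

Lemma kernel_mixtureE (x : T) (A : set U) :
  kernel_mixture x A = (t%:E * k1 x A + (1 - t)%:E * k2 x A)%E.
Proof. exact: measure_addE. Qed.

Let measurable_kernel_mixture (A : set U) : measurable A ->
  measurable_fun setT (kernel_mixture ^~ A).
Proof.
move=> mA; under eq_fun do rewrite kernel_mixtureE.
by apply: emeasurable_funD; apply: measurable_funeM; exact: measurable_kernel.
Qed.

HB.instance Definition _ :=
  isKernel.Build _ _ _ _ _ kernel_mixture measurable_kernel_mixture.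

Let kernel_mixtureT (x : T) : kernel_mixture x setT = 1%E.
Proof.
by rewrite kernel_mixtureE !prob_kernel !mule1 -EFinD addrC subrK.
Qed.

HB.instance Definition _ :=
  Kernel_isProbability.Build _ _ _ _ _ kernel_mixture kernel_mixtureT.

Lemma ge0_integral_kernel_mixture (x : T) (f : U -> \bar R) :
  (forall y, 0 <= f y)%E -> measurable_fun setT f ->
  (\int[kernel_mixture x]_y f y =
   t%:E * \int[k1 x]_y f y + (1 - t)%:E * \int[k2 x]_y f y)%E.
Proof.
move=> f0 mf.
by rewrite ge0_integral_measure_add// !ge0_integral_mscale.
Qed.

End kernel_mixture.

(** * Measurable selection of near-maximisers *)

Lemma measurable_approx_argmax d (T : measurableType d) (Y : ptopologicalType)
    (R : realType) (h : T -> Y -> R) (delta : R) :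
  separable Y -> 0 < delta ->
  (forall v, measurable_fun setT (h ^~ v)) -> (forall x, continuous (h x)) ->
  let H x := ereal_sup [set (h x v)%:E | v in [set: Y]] in
  measurable_fun setT H -> (forall x, H x < +oo)%E ->
  exists (D : nat -> Y) (n : T -> nat),
    (forall k, measurable (n @^-1` [set k])) /\
    forall x, (H x <= (h x (D (n x)) + delta)%:E)%E.
Proof.
move=> [D0 cD dD] delta0 mh ch H mH Hoo.
(* Indices that [f] does not reach are sent to [point]; only the inclusion of [D0] in the range
   matters. *)
have [D rD] : exists D : nat -> Y, D0 `<=` range D.
  have /countable_injP[f finj] := cD.
  exists (fun n => xget point [set y | D0 y /\ f y = n]) => y D0y.
  exists (f y) => //; case: xgetP => [z _ [D0z fzy]|/(_ y)].
    by apply: finj; rewrite ?inE.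
  by case.
have exk x : exists k, `[< (H x <= (h x (D k) + delta)%:E)%E >].
  have Hfin : H x \is a fin_num.
    rewrite fin_numElt Hoo andbT (@lt_le_trans _ _ (h x point)%:E) ?ltNyr//.
    by apply: ereal_sup_ubound; exists point.
  have [r Hr] : exists r, H x = r%:E by exists (fine (H x)); rewrite fineK.
  (* Strictness makes the set of such points open by continuity, so the dense set meets it. *)
  have [v Hv] : exists v, (H x < (h x v + delta)%:E)%E.
    have [_ [v _ <-]] := ub_ereal_sup_adherent delta0 Hfin.
    by exists v; rewrite EFinD -lteBlDr.
  have [] := dD [set y | (H x < (h x y + delta)%:E)%E].
  - by exists v.
  - rewrite (_ : [set _ | _] = h x @^-1` `]r - delta, +oo[).
      by move/continuousP : (ch x); apply; exact: interval_open.
    apply/seteqP; split => y;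
      by rewrite /= in_itv/= andbT Hr lte_fin ltrBlDr.
  - move=> y [/= Hy /rD[k _ Dky]]; exists k; apply/asboolP.
    by rewrite Dky ltW.
(* The least good index is measurable in [x]: it equals [k] exactly when [k] is good and no smaller
   index is. *)
exists D, (fun x => ex_minn (exk x)); split => [k|x]; last first.
  by case: ex_minnP => k /asboolP.
have mP j : measurable [set x | (H x <= (h x (D j) + delta)%:E)%E].
  rewrite -[X in measurable X]setTI; apply: emeasurable_fun_le => //.
  apply/measurable_EFinP; exact: measurable_funD.
rewrite (_ : _ @^-1` _ = [set x | (H x <= (h x (D k) + delta)%:E)%E] `&`
    \bigcap_(j in [set j | (j < k)%N])
      ~` [set x | (H x <= (h x (D j) + delta)%:E)%E]).
  apply: measurableI => //; apply: bigcap_measurableType => j _.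
  exact: measurableC.
apply/seteqP; split => [x /=|x /= [Hk Hj]].
  case: ex_minnP => j /asboolP Hj jmin <-; split => // i /= ij /asboolP/jmin.
  by rewrite leqNgt ij.
case: ex_minnP => j /asboolP Hj' jmin; apply/eqP; rewrite eqn_leq.
rewrite jmin ?andTb; last exact/asboolP.
by rewrite leqNgt; apply/negP => /Hj.
Qed.

(** * Averages of a function of two points against a kernel *)

Section kernel_average.
Context (R : realType) (S : ptopologicalType).
Variable mu : probability (borel S) R.
Hypothesis scS : @second_countable S.
Local Open Scope ereal_scope.

(** Taking [f = c] gives the transport cost, and [f s r = l r g] the expected loss. *)
Definition kernel_average (pi : R.-pker (completed mu) ~> (borel S))
    (f : S -> S -> R) : \bar R :=
  \int[completion mu]_s \int[pi s]_r (f s r)%:E.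

Variable f : S -> S -> R.
Hypothesis f_ge0 : forall s r, (0 <= f s r)%R.
Hypothesis f_cont : continuous (fun p : S * S => f p.1 p.2).

Lemma continuous_section (s : S) : continuous (f s).
Proof.
move=> r; apply: (@continuous_comp _ _ _ (fun r => (s, r))
  (fun p : S * S => f p.1 p.2)).
  by apply: cvg_pair => //=; exact: cvg_cst.
exact: f_cont.
Qed.

Lemma measurable_section (s : S) : measurable_fun [set: borel S] (EFin \o f s).
Proof.
apply/measurable_EFinP; apply: continuous_borel_measurable.
exact: continuous_section.
Qed.

(** Joint continuity gives measurability on the product of two Borel spaces; precomposing the first
    factor with the identity moves it to the completed space, where [pi] is a kernel. *)
Lemma measurable_kernel_section (pi : R.-pker (completed mu) ~> (borel S)) :
  measurable_fun [set: completed mu] (fun s => \int[pi s]_r (f s r)%:E).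
Proof.
apply: (measurable_fun_integral_finite_kernel
  (fun p : completed mu * borel S => (f p.1 p.2)%:E) pi).
  by move=> p; rewrite lee_fin.
apply/measurable_EFinP.
have mf := @continuous_prod_borel_measurable R S S _ scS scS f_cont.
have mid : measurable_fun setT (idfun : completed mu -> borel S).
  by apply: measurable_fun_completed; exact: measurable_id.
have mpair := measurable_fun_pair
  (measurableT_comp mid (@measurable_fst _ _ (completed mu) (borel S)))
  (@measurable_snd _ _ (completed mu) (borel S)).
exact: (measurableT_comp mf mpair).
Qed.

(** This affine dependence on the kernel makes the attainable pairs of cost and loss a convex
    set. *)
Lemma kernel_average_mixture (t : R) (t0 : (0 <= t)%R) (t1 : (0 <= 1 - t)%R)
    (k1 k2 : R.-pker (completed mu) ~> (borel S)) :
  kernel_average (kernel_mixture t0 t1 k1 k2) f =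
  t%:E * kernel_average k1 f + (1 - t)%:E * kernel_average k2 f.
Proof.
have inner0 (k : R.-pker (completed mu) ~> (borel S)) s :
  0 <= \int[k s]_r (f s r)%:E by apply: integral_ge0 => r _; rewrite lee_fin.
have innerM (k : R.-pker (completed mu) ~> (borel S)) (a : R) : (0 <= a)%R ->
    measurable_fun setT (fun s => a%:E * \int[k s]_r (f s r)%:E).
  by move=> _; apply: measurable_funeM; exact: measurable_kernel_section.
rewrite /kernel_average.
rewrite -(ge0_integralZl _ measurableT (measurable_kernel_section k1))//.
rewrite -(ge0_integralZl _ measurableT (measurable_kernel_section k2))//.
rewrite -(ge0_integralD _ measurableT _ (innerM k1 _ t0) _ (innerM k2 _ t1));
  last 2 first.
- by move=> s _; exact: mule_ge0.
- by move=> s _; exact: mule_ge0.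
apply: eq_integral => s _; apply: ge0_integral_kernel_mixture.
  by move=> r; rewrite lee_fin.
exact: measurable_section.
Qed.

Lemma measurable_graph (T : borel S -> borel S) : measurable_fun setT T ->
  measurable_fun setT (fun s : borel S => (f s (T s))%:E).
Proof.
move=> mT; apply/measurable_EFinP.
have mf := @continuous_prod_borel_measurable R S S _ scS scS f_cont.
have mpair : measurable_fun setT (fun s : borel S => (s, T s)).
  by apply: measurable_fun_pair => //; exact: measurable_id.
exact: (measurableT_comp mf mpair).
Qed.

(** The inner integral collapses to [f s (T s)], which is Borel measurable in [s], so the completion
    can be replaced by [mu]. *)
Lemma kernel_average_dirac (T : borel S -> borel S)
    (mT : measurable_fun setT T) :
  kernel_average (kdirac (measurable_fun_completed mu mT)) f =
  \int[mu]_s (f s (T s))%:E.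
Proof.
rewrite -ge0_integral_completion; last 2 first.
- by move=> s; rewrite lee_fin.
- exact: measurable_graph.
apply: eq_integral => s _.
rewrite integral_dirac//; last exact: measurable_section.
by rewrite diracT mul1e.
Qed.

Lemma integral_graph_fin_num (M : R) (T : borel S -> borel S) :
  measurable_fun setT T -> (forall s r, (f s r <= M)%R) ->
  \int[mu]_s (f s (T s))%:E \is a fin_num.
Proof.
move=> mT fM; rewrite ge0_fin_numE; last first.
  by apply: integral_ge0 => s _; rewrite lee_fin.
apply: le_lt_trans (ltry M).
rewrite -[leRHS]mule1 -(probability_setT mu) -(integral_cst mu measurableT).
apply: ge0_le_integral => //.
- by move=> s _; rewrite lee_fin.
- exact: measurable_graph.
- by move=> s _; rewrite lee_fin.
Qed.

End kernel_average.

(** * Measures carried by the fibre over the first coordinate *)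

Section K_dirac.
Context (R : realType) (X Y : ptopologicalType).
Local Notation S := (X * Y)%type.
Variable mu : probability (borel S) R.
Local Open Scope ereal_scope.

(** The constant kernel with value the Dirac mass at [(T s).2] is a witness: as [T s] lies over
    [s.1], the product of the two Dirac masses is the Dirac mass at [T s]. *)
Lemma K_dirac_dirac (T : borel S -> borel S) (mT : measurable_fun setT T) s :
  (T s).1 = s.1 ->
  K_dirac R s (pker_at (kdirac (measurable_fun_completed mu mT)) s).
Proof.
move=> Ts.
have mcst : measurable_fun setT (cst (T s).2 : borel X -> borel Y).
  exact: measurable_cst.
exists (kdirac mcst) => A mA.
have mxs : measurable_fun setT
    (fun x : borel X => \d_((T s).2 : borel Y) (xsection A x) : \bar R).
  have -> :
      (fun x : borel X => \d_((T s).2 : borel Y) (xsection A x) : \bar R) =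
    EFin \o (\1_((fun x : X => (x, (T s).2)) @^-1` A) : borel X -> R).
    apply/funext => x; rewrite /= diracE indicE; congr ((nat_of_bool _)%:R%:E).
    by apply/idP/idP; rewrite !inE /xsection /= inE.
  apply/measurable_EFinP; apply: measurable_indic.
  rewrite -[X in measurable X]setTI.
  apply: (@continuous_borel X S (fun x => (x, (T s).2))) => //.
  by move=> x; apply: cvg_pair; [exact: cvg_id|exact: cvg_cst].
rewrite /product_measure1 integral_dirac//= diracT mul1e.
rewrite /pker_at /kdirac /= !diracE; congr ((nat_of_bool _)%:R%:E).
by apply/idP/idP; rewrite !inE /xsection /= inE -Ts -surjective_pairing.
Qed.

Lemma measurable_neq_fst (x : X) : hausdorff_space X ->
  measurable ([set r | r.1 <> x] : set (borel S)).
Proof.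
move=> hX.
have oX : open (~` [set x]).
  by rewrite openC; apply: accessible_closed_set1; exact: hausdorff_accessible.
apply: open_borel_measurable.
rewrite openE => -[x' y] /= xx'; exists (~` [set x], setT) => /=.
  by split; [apply: open_nbhs_nbhs|exact: filterT].
by move=> r [].
Qed.

(** The points off the fibre form a rectangle whose first side misses [s.1], so the Dirac factor
    gives it mass zero. *)
Lemma K_dirac_off (s : S) (nu : probability (borel S) R) :
  hausdorff_space X -> K_dirac R s nu -> nu [set r | r.1 <> s.1] = 0.
Proof.
move=> hX [kappa nuE].
have oX : open (~` [set s.1]).
  by rewrite openC; apply: accessible_closed_set1; exact: hausdorff_accessible.
have -> : [set r : S | r.1 <> s.1] = (~` [set s.1]) `*` setT.
  by apply/seteqP; split => [r //|r []].
rewrite nuE; last first.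
  rewrite (_ : _ `*` _ = [set r | r.1 <> s.1]); first exact: measurable_neq_fst.
  by apply/seteqP; split => [r []|r //].
(* The rectangle formula wants a sigma-finite second factor; [pker_at] presents it as a
   probability. *)
rewrite (_ : kappa _ = pker_at kappa s.1 :> (_ -> _)) // product_measure1E.
- rewrite [X in X * _](_ : _ = 0) ?mul0e//.
  by rewrite /= /dirac indicE memNset//; apply.
- exact: open_borel_measurable.
- exact: measurableT.
Qed.

End K_dirac.

(** * Bounds obtained from compactness *)

Lemma continuous_pair (T U V : topologicalType) (f : T -> U) (h : T -> V) :
  continuous f -> continuous h -> continuous (fun x => (f x, h x)).
Proof. by move=> cf ch x; apply: cvg_pair; [exact: cf|exact: ch]. Qed.

Lemma compact_bounded_above (R : realType) (T : topologicalType) (f : T -> R) :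
  compact [set: T] -> continuous f -> exists2 M, 0 <= M & forall x, f x <= M.
Proof.
move=> cT cf; have [[x0]|noT] := pselect (exists x : T, True); last first.
  by exists 0 => // x; exfalso; apply: noT; exists x.
have neT : [set: T] !=set0 by exists x0.
have [x _ fx] := compact_EVT_max neT cT (continuous_subspaceT cf).
exists (Num.max 0 (f x)) => [|y]; rewrite le_max ?lexx//.
by rewrite fx ?orbT// inE.
Qed.

(* Where the increment of [f] is at least [delta], compactness keeps [c] away
   from [0]. *)
Lemma compact_increment_le (R : realType) (S : topologicalType)
    (c : S -> S -> R) (f : S -> R) (delta : R) :
  compact [set: S] -> continuous (fun p : S * S => c p.1 p.2) ->
  (forall s r, 0 <= c s r) -> (forall s r, c s r = 0 -> s = r) ->
  (forall s, 0 <= f s) -> continuous f -> 0 < delta ->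
  exists2 lambda, 0 <= lambda &
    forall s r, f r <= f s + delta + lambda * c s r.
Proof.
move=> cS cc c0 c_eq0 f0 cf delta0.
have [M M0 fM] := compact_bounded_above cS cf.
pose D := [set p : S * S | delta <= f p.2 - f p.1].
have cD : compact D.
  apply: (@subclosed_compact _ _ [set: S * S]) => //; last first.
    by rewrite -setXTT; exact: compact_setX.
  rewrite (_ : D = (fun p => f p.2 - f p.1) @^-1` [set x | delta <= x]) //.
  apply: closed_comp; last exact: closed_ge.
  move=> p _; apply: continuousB.
    by apply: continuous_comp; [exact: cvg_snd|exact: cf].
  by apply: continuous_comp; [exact: cvg_fst|exact: cf].
have [D0|/set0P/negP/negPn/eqP D0] := pselect (D !=set0); last first.
  exists 0 => // s r; rewrite mul0r addr0.
  have : ~ D (s, r) by rewrite D0.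
  by move=> /negP; rewrite -ltNge /=; lra.
have [[s0 r0] Dsr0 cmin] := compact_EVT_min D0 cD (continuous_subspaceT cc).
have m0 : 0 < c s0 r0.
  rewrite lt_def c0 andbT; apply/eqP => /c_eq0 sr0.
  by move: Dsr0; rewrite inE /D /= sr0 subrr leNgt delta0.
(* On [D] the increment is at most [M] and [c] is at least its minimum [c s0 r0], so the linear term
   alone covers it; off [D] the term [delta] does. *)
exists (M / c s0 r0) => [|s r]; first by rewrite divr_ge0// c0.
have cfM : 0 <= M / c s0 r0 * c s r by rewrite mulr_ge0// divr_ge0// c0.
have [Dsr|] := leP delta (f r - f s); last by lra.
have := cmin (s, r); rewrite inE => /(_ Dsr) /= cle.
have : M <= M / c s0 r0 * c s r.
  by rewrite mulrAC ler_pdivlMr// ler_wpM2l.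
by have := fM r; have := f0 s; lra.
Qed.

(** * Weak duality, and the dual bounds for positive and zero budget *)

Section duality.
Context (R : realType) (X Y : ptopologicalType) (G : Type).
Local Notation S := (X * Y)%type.
Variable mu : probability (borel S) R.
Hypotheses (hX : polish R X) (hY : polish R Y) (hS : compact [set: S]).
Variables (c : S -> S -> R) (l : S -> G -> R) (g : G).
Hypothesis c_ge0 : forall s r, 0 <= c s r.
Hypothesis c_cont : continuous (fun p : S * S => c p.1 p.2).
Hypothesis c_eq0 : forall s r, c s r = 0 <-> s = r.
Hypothesis l_ge0 : forall s g, 0 <= l s g.
Hypothesis l_cont : continuous (l ^~ g).

Let scS : @second_countable S.
Proof.
by apply: second_countable_prod; [exact: polish_second_countable hX|
  exact: polish_second_countable hY].
Qed.

(** The dummy first argument lets the loss be averaged by [kernel_average]. *)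
Let gain (_ r : S) := l r g.

Let gain_ge0 s r : 0 <= gain s r. Proof. exact: l_ge0. Qed.

Let gain_cont : continuous (fun p : S * S => gain p.1 p.2).
Proof. by move=> p; apply: continuous_comp; [exact: cvg_snd|exact: l_cont]. Qed.

Let penalized lambda (s : S) (v : Y) := l (s.1, v) g - lambda * c s (s.1, v).

Let penalized_pair_cont lambda :
  continuous (fun p : S * S => l p.2 g - lambda * c p.1 p.2).
Proof.
move=> p.
apply: (@continuousB _ _ _ (fun p : S * S => l p.2 g)
  (fun p : S * S => lambda * c p.1 p.2)); first exact: gain_cont.
apply: (@continuousM _ _ (fun=> lambda) (fun p : S * S => c p.1 p.2)).
  exact: cst_continuous.
exact: c_cont.
Qed.

Let penalized_contl lambda v : continuous (penalized lambda ^~ v).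
Proof.
have csv : continuous (fun s : S => (s, (s.1, v))).
  apply: (@continuous_pair _ _ _ idfun); first by move=> s A.
  apply: (@continuous_pair _ _ _ fst (cst v)) => s; last exact: cvg_cst.
  exact: cvg_fst.
move=> s; apply: (@continuous_comp _ _ _ (fun s : S => (s, (s.1, v)))
  (fun p : S * S => l p.2 g - lambda * c p.1 p.2)); first exact: csv.
exact: penalized_pair_cont.
Qed.

Let penalized_contr lambda s : continuous (penalized lambda s).
Proof.
have csv : continuous (fun v : Y => (s, (s.1, v))).
  apply: continuous_pair => [v|]; first exact: cvg_cst.
  by apply: continuous_pair => v; [exact: cvg_cst|exact: cvg_id].
move=> v; apply: (@continuous_comp _ _ _ (fun v : Y => (s, (s.1, v)))
  (fun p : S * S => l p.2 g - lambda * c p.1 p.2)); first exact: csv.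
exact: penalized_pair_cont.
Qed.

Local Open Scope ereal_scope.

Let le_phi lambda s v :
  (l (s.1, v) g - lambda * c s (s.1, v))%:E <= phi l c lambda g s.
Proof. by apply: ereal_sup_ubound; exists v. Qed.

(** The choice [v = s.2] costs nothing and yields [l s g]. *)
Let phi_ge0 lambda s : 0 <= phi l c lambda g s.
Proof.
apply: le_trans (le_phi lambda s s.2); rewrite lee_fin -surjective_pairing.
by rewrite (c_eq0 s s).2// mulr0 subr0.
Qed.

(** A supremum of continuous functions is lower semicontinuous: its strict superlevel sets are
    unions of open sets, even over an uncountable [Y]. *)
Let measurable_phi lambda : measurable_fun [set: borel S] (phi l c lambda g).
Proof.
apply: (measurability _ (ErealGenOInfty.measurableE R)).
move=> _ [_ [x ->] <-]; rewrite setTI; apply: open_borel_measurable.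
rewrite (_ : _ @^-1` _ =
    \bigcup_v [set s | (x < penalized lambda s v)%R]); last first.
  apply/seteqP; split => [s|s [v _ /= xv]].
    rewrite /= in_itv/= andbT => /ereal_sup_gt[_ [v _ <-]].
    by rewrite lte_fin => xv; exists v.
  rewrite /= in_itv/= andbT; apply: lt_le_trans (le_phi lambda s v).
  by rewrite lte_fin.
apply: bigcup_open => v _.
rewrite (_ : [set s | _] = (penalized lambda ^~ v) @^-1` `]x, +oo[).
  have /continuousP := @penalized_contl lambda v.
  by apply; exact: interval_open.
by apply/seteqP; split => s; rewrite /= in_itv/= andbT.
Qed.

(** The cost term stands on the right, so that every integrand is nonnegative and infinite values
    need no separate treatment. *)
Lemma weak_duality (pi : R.-pker (completed mu) ~> (borel S)) (lambda : R) :
  (0 <= lambda)%R ->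
  (\forall s \ae completion mu, K_dirac R s (pker_at pi s)) ->
  kernel_average pi gain <=
    \int[mu]_s phi l c lambda g s + lambda%:E * kernel_average pi c.
Proof.
move=> lambda0 Kpi.
have inner0 s : 0 <= \int[pi s]_r (c s r)%:E.
  by apply: integral_ge0 => r _; rewrite lee_fin.
have mphi : measurable_fun [set: completed mu] (phi l c lambda g).
  exact: (measurable_fun_completed mu (@measurable_phi lambda)).
have mc := @measurable_kernel_section R S mu scS c c_ge0 c_cont pi.
rewrite -(ge0_integral_completion mu _ (@measurable_phi lambda))//.
rewrite -(ge0_integralZl _ measurableT mc)//.
rewrite -(ge0_integralD _ measurableT _ mphi _ (measurable_funeM _ mc))//;
  last first.
  by move=> s _; exact: mule_ge0.
apply: (@ae_ge0_le_integral _ _ _ _ setT measurableT).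
- by move=> s _; apply: integral_ge0 => r _; rewrite lee_fin.
- exact: (@measurable_kernel_section R S mu scS gain).
- by move=> s _; rewrite adde_ge0// mule_ge0.
- exact: (emeasurable_funD mphi (measurable_funeM _ mc)).
apply: (@filterS _ _ (completion_ae_filter mu) _ _ _ Kpi) => s Ks _.
have msec := @measurable_section R S c c_cont s.
rewrite -(ge0_integralZl _ measurableT msec)//; last first.
  by move=> r _; rewrite lee_fin.
(* The constant [phi l c lambda g s] becomes its own integral against the probability [pi s], so two
   integrands can be compared. *)
rewrite -[X in X + _](mule1 (phi l c lambda g s)).
rewrite -(@prob_kernel _ _ _ _ _ pi s).
rewrite -(integral_cst (pi s) measurableT).
rewrite -(ge0_integralD _ measurableT); last 4 first.
- by move=> r _; exact: phi_ge0.
- exact: measurable_cst.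
- by move=> r _; rewrite mule_ge0// lee_fin.
- exact: measurable_funeM.
apply: (@ae_ge0_le_integral _ _ _ _ setT measurableT).
- by move=> r _; rewrite lee_fin.
- exact: (@measurable_section R S gain gain_cont s).
- move=> r _; apply: adde_ge0; first exact: phi_ge0.
  by apply: mule_ge0; rewrite lee_fin.
- exact: (emeasurable_funD (measurable_cst _) (measurable_funeM _ msec)).
(* The pointwise bound can fail only off the fibre, which is null for [pi s]. *)
exists [set r | r.1 <> s.1]; split.
- exact: measurable_neq_fst (polish_hausdorff hX).
- exact: K_dirac_off (polish_hausdorff hX) Ks.
move=> r /= /not_implyP[_ nle] rs; apply: nle.
have := le_phi lambda s r.2; rewrite -rs -surjective_pairing.
by rewrite -EFinM EFinB leeBlDr.
Qed.

Lemma approx_argmax_map (lambda delta : R) : (0 <= lambda)%R -> (0 < delta)%R ->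
  exists T : borel S -> borel S, [/\ measurable_fun setT T,
    forall s, (T s).1 = s.1 &
    forall s,
      phi l c lambda g s <= (l (T s) g - lambda * c s (T s) + delta)%:E].
Proof.
move=> lambda0 delta0.
have [M _ lM] := compact_bounded_above hS l_cont.
have [v|s|s|D [n [mn Dn]]] := @measurable_approx_argmax _ (borel S) Y R
    (penalized lambda) delta hY.1 delta0 _ _ (@measurable_phi lambda).
- by apply: continuous_borel_measurable; exact: (@penalized_contl lambda v).
- exact: (@penalized_contr lambda s).
- apply: (@le_lt_trans _ _ M%:E); last exact: ltry.
  apply: ge_ereal_sup => _ [v _ <-]; rewrite lee_fin.
  by rewrite lerBlDr (le_trans (lM _))// lerDl mulr_ge0.
exists (fun s => (s.1, D (n s))); split => // _ A mA; rewrite setTI.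
(* On each piece where [n] is constant the map is the continuous [s |-> (s.1, D k)]. *)
rewrite (_ : _ @^-1` _ =
    \bigcup_k ((n @^-1` [set k]) `&` (fun s : S => (s.1, D k)) @^-1` A)).
  apply: bigcupT_measurable => k; apply: measurableI; first exact: mn.
  rewrite -[X in measurable X]setTI.
  apply: (@continuous_borel S S (fun s => (s.1, D k))) => //.
  apply: (@continuous_pair _ _ _ fst (cst (D k))) => s; last exact: cvg_cst.
  exact: cvg_fst.
apply/seteqP; split => [s /= As|s [k _ [/= <-]]//].
by exists (n s).
Qed.

Lemma dual_le_of_gain_le (eps w : R) :
  (0 < eps)%R ->
  (\forall s \ae completion mu, convex_prob (K_dirac R (s : S))) ->
  (forall pi : R.-pker (completed mu) ~> (borel S),
    (\forall s \ae completion mu, K_dirac R s (pker_at pi s)) ->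
    kernel_average pi c <= eps%:E -> kernel_average pi gain <= w%:E) ->
  exists2 lambda : R, (0 <= lambda)%R &
    (lambda * eps)%:E + \int[mu]_s phi l c lambda g s <= w%:E.
Proof.
move=> eps0 Kconv gain_le.
pose Z := [set z : R * R | exists pi : R.-pker (completed mu) ~> (borel S),
  [/\ \forall s \ae completion mu, K_dirac R s (pker_at pi s),
      kernel_average pi c = z.1%:E & kernel_average pi gain = z.2%:E]].
have cSS : compact [set: S * S] by rewrite -setXTT; exact: compact_setX.
have [C _ cC] := compact_bounded_above cSS c_cont.
have [M _ lM] := compact_bounded_above hS l_cont.
(* Boundedness of [c] and the loss makes both averages finite, so deterministic kernels give real
   pairs. *)
have Zdirac (T : borel S -> borel S) : measurable_fun setT T ->
    (forall s, (T s).1 = s.1) ->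
    Z (fine (\int[mu]_s (c s (T s))%:E), fine (\int[mu]_s (l (T s) g)%:E)).
  move=> mT T1; exists (kdirac (measurable_fun_completed mu mT)); split => /=.
  - by apply: aeW => s; exact: K_dirac_dirac.
  - rewrite kernel_average_dirac// fineK//.
    exact: (@integral_graph_fin_num R S mu scS c c_ge0 c_cont C _ _
      (fun s r => cC (s, r))).
  - rewrite kernel_average_dirac// fineK//.
    exact: (@integral_graph_fin_num R S mu scS gain gain_ge0 gain_cont M).
have [||[a b] [pi [Kpi /= costE gainE]] /= ae|lambda lambda0 Zle] :=
    @convex_supergradient R Z eps w.
- move=> t z1 z2 /andP[t0 t1] [k1 [K1 c1 g1]] [k2 [K2 c2 g2]].
  have t1' : (0 <= 1 - t)%R by rewrite subr_ge0.
  exists (kernel_mixture t0 t1' k1 k2); split => /=.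
  + apply: (@filterS3 _ _ (completion_ae_filter mu) _ _ _ _ _
      Kconv K1 K2) => s Ks Ks1 Ks2.
    apply: (Ks t _ _ _ _ Ks1 Ks2); first by rewrite t0.
    by move=> A mA; exact: kernel_mixtureE.
  + by rewrite kernel_average_mixture// c1 c2.
  + by rewrite kernel_average_mixture// g1 g2.
(* The identity has cost zero, strictly below [eps]. *)
- eexists; first exact: (Zdirac idfun (@measurable_id _ _ _)).
  by rewrite /= integral0_eq// => s _; rewrite (c_eq0 s s).2.
- by rewrite -lee_fin -gainE; apply: gain_le => //; rewrite costE lee_fin.
(* [lambda] is fixed before [delta]; only the near-maximiser [T] depends on [delta]. *)
exists lambda => //; apply/lee_addgt0Pr => delta delta0.
have [T [mT T1 phiT]] := approx_argmax_map lambda0 delta0.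
have mc := measurable_graph scS c_cont mT.
have ml := measurable_graph scS gain_cont mT.
have phi_le : \int[mu]_s phi l c lambda g s +
    lambda%:E * \int[mu]_s (c s (T s))%:E <=
    \int[mu]_s (l (T s) g)%:E + delta%:E.
  rewrite -(ge0_integralZl _ measurableT mc)//; last first.
    by move=> s _; rewrite lee_fin.
  rewrite -(ge0_integralD _ measurableT _ _ _ (measurable_funeM _ mc))//;
    last first.
    by move=> s _; rewrite -EFinM lee_fin mulr_ge0.
  rewrite -[X in _ + X]mule1 -(probability_setT mu).
  rewrite -(integral_cst mu measurableT).
  rewrite -(ge0_integralD _ measurableT _ ml _ (measurable_cst _))//;
    last 2 first.
  - by move=> s _; rewrite lee_fin.
  - by move=> s _; rewrite lee_fin ltW.
  apply: ge0_le_integral => //.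
  - by move=> s _; rewrite adde_ge0// -EFinM lee_fin mulr_ge0.
  - exact: (emeasurable_funD (@measurable_phi lambda) (measurable_funeM _ mc)).
  - exact: (emeasurable_funD ml (measurable_cst _)).
  - move=> s _; apply: le_trans (leeD2r _ (phiT s)) _.
    by rewrite /cst /gain -EFinM -!EFinD lee_fin; lra.
have := Zle _ (Zdirac T mT T1); rewrite /=.
have cfin := @integral_graph_fin_num R S mu scS c c_ge0 c_cont C T mT
  (fun s r => cC (s, r)).
have lfin := @integral_graph_fin_num R S mu scS gain gain_ge0 gain_cont M T mT
  (fun _ => lM).
move: phi_le; rewrite -(fineK cfin) -(fineK lfin) /=.
set a := fine _; set b := fine _.
(* Nonnegativity excludes the value [-oo], and the finite right side of [phi_le] excludes [+oo]. *)
have : 0 <= \int[mu]_s phi l c lambda g s by exact: integral_ge0.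
case: (\int[mu]_s phi l c lambda g s) => [p _||] //.
by rewrite -EFinM -!EFinD !lee_fin; lra.
Qed.

(** For the slope given by [compact_increment_le], moving along a fibre never improves the penalised
    loss by more than [delta]. *)
Lemma integral_phi_le (delta : R) : (0 < delta)%R ->
  exists2 lambda : R, (0 <= lambda)%R &
    \int[mu]_s phi l c lambda g s <= \int[mu]_s (l s g)%:E + delta%:E.
Proof.
move=> delta0.
have [lambda lambda0 lle] := compact_increment_le hS c_cont c_ge0
  (fun s r => (c_eq0 s r).1) (l_ge0 ^~ g) l_cont delta0.
exists lambda => //.
have ml := measurable_graph scS gain_cont (@measurable_id _ (borel S) setT).
rewrite -[X in _ + X]mule1 -(probability_setT mu).
rewrite -(integral_cst mu measurableT).
rewrite -(ge0_integralD _ measurableT _ ml _ (measurable_cst _))//;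
  last 2 first.
- by move=> s _; rewrite lee_fin.
- by move=> s _; rewrite lee_fin ltW.
apply: ge0_le_integral => //.
- exact: (emeasurable_funD ml (measurable_cst _)).
- move=> s _; apply: ge_ereal_sup => _ [v _ <-].
  by rewrite -EFinD lee_fin lerBlDr; exact: lle.
Qed.

Lemma kernel_average_id (h : S -> S -> R) :
  (forall s r, 0 <= h s r)%R -> continuous (fun p : S * S => h p.1 p.2) ->
  kernel_average (kdirac (measurable_fun_completed mu
    (@measurable_id _ (borel S) setT))) h =
  \int[mu]_s (h s s)%:E.
Proof. by move=> h0 hc; rewrite kernel_average_dirac. Qed.

End duality.

(** * Equality of the primal and dual values *)

Theorem theorem3p3 (R : realType) (X Y : ptopologicalType)
    (dG : measure_display) (G : measurableType dG)
    (hX : polish R X) (hY : polish R Y) (hS : compact [set: X * Y])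
    (mu : probability (borel (X * Y)%type) R)
    (eps : R) (eps_ge0 : 0 <= eps)
    (c : X * Y -> X * Y -> R)
    (c_ge0 : forall s r, 0 <= c s r)
    (c_cont : continuous (fun p : (X * Y) * (X * Y) => c p.1 p.2))
    (c_eq0 : forall s r, c s r = 0 <-> s = r)
    (l : X * Y -> G -> R)
    (l_ge0 : forall s g, 0 <= l s g)
    (l_meas : measurable_fun [set: (borel (X * Y) * G)%type] (fun p => l p.1 p.2))
    (g : G)
    (l_cont : continuous (l ^~ g))
    (hK : {ae mu, forall s, [/\ K_dirac R s !=set0,
                                weak_star_closed (K_dirac R s) &
                                convex_prob (K_dirac R s)]})
    (hOmega : Omega mu (K_dirac R) c eps !=set0) :
  worst_case l (Omega mu (K_dirac R) c eps) g =
  ereal_inf [set ((lambda * eps)%:E + \int[mu]_s phi l c lambda g s)%E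
            | lambda in [set lambda : R | 0 <= lambda]].
Proof.
have gain_cont : continuous (fun p : (X * Y) * (X * Y) => l p.2 g).
  move=> p; apply: (@continuous_comp _ _ _ snd (l ^~ g)); first exact: cvg_snd.
  exact: l_cont.
have weak := weak_duality hX hY c_ge0 c_cont c_eq0 l_ge0 l_cont.
apply/eqP; rewrite eq_le; apply/andP; split.
  apply: le_ereal_inf_tmp => _ [lambda /= lambda0 <-].
  apply: ge_ereal_sup => _ [pi [Kpi cost_pi] <-].
  apply: le_trans (weak _ _ _ lambda0 Kpi) _; rewrite addeC leeD2r//.
  by rewrite EFinM lee_wpmul2l.
have adm_id : {ae completion mu, forall s, K_dirac R s
    (pker_at (kdirac (measurable_fun_completed mu
      (@measurable_id _ (borel (X * Y)%type) setT))) s)}.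
  by apply: aeW => s; exact: K_dirac_dirac.
have [eps0|eps_neq0] := eqVneq eps 0.
  (* At zero budget the identity kernel is feasible and earns the integral of the loss, while
     [lambda * eps] vanishes however large [lambda] is. *)
  apply/lee_addgt0Pr => delta delta0.
  have [lambda lambda0 le_delta] :=
    integral_phi_le mu hX hY hS c_ge0 c_cont c_eq0 l_ge0 l_cont delta0.
  apply: ge_ereal_inf; exists (\int[mu]_s phi l c lambda g s)%E.
    by exists lambda => //; rewrite eps0 mulr0 add0e.
  apply: le_trans le_delta _; rewrite leeD2r//; apply: ereal_sup_ubound.
  exists (kdirac (measurable_fun_completed mu
      (@measurable_id _ (borel (X * Y)%type) setT))).
    split => //; rewrite -/(kernel_average _ c) kernel_average_id//.
    by rewrite eps0 integral0_eq// => s _; rewrite (c_eq0 s s).2.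
  by rewrite -/(kernel_average _ (fun _ r => l r g)) kernel_average_id.
have {eps_neq0}eps0 : 0 < eps by rewrite lt_def eps_neq0.
have wc_ge0 : (0 <= worst_case l (Omega mu (K_dirac R) c eps) g)%E.
  have [pi piO] := hOmega.
  apply: le_trans (ereal_sup_ubound (ex_intro2 _ _ pi piO erefl)).
  by apply: integral_ge0 => s _; apply: integral_ge0 => r _; rewrite lee_fin.
have wc_ub (pi : R.-pker completed mu ~> borel (X * Y)%type) :
    Omega mu (K_dirac R) c eps pi ->
    (kernel_average pi (fun _ r => l r g) <=
      worst_case l (Omega mu (K_dirac R) c eps) g)%E.
  by move=> piO; apply: ereal_sup_ubound; exists pi.
(* An infinite worst case makes the bound trivial; otherwise its real value [w] bounds the loss of
   every feasible kernel. *)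
move: (worst_case _ _ _) wc_ge0 wc_ub => [w||//] _ wc_ub; last exact: leey.
have [|pi Kpi cost_pi|lambda lambda0 le_w] :=
  @dual_le_of_gain_le R X Y G mu hX hY hS c l g c_ge0 c_cont c_eq0 l_ge0 l_cont
    eps w eps0.
- have := ae_completed hK.
  by apply: (@filterS _ _ (completion_ae_filter mu)) => s [].
- by apply: wc_ub; split.
by apply: ge_ereal_inf; eexists; [exists lambda|exact: le_w].
Qed.
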